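(* $BQC(HAM_n^{n/2})=\Omega(n/\log n)$.
   Context: For even $n$ and $x,y\in\{0,1\}^n$, $HAM^t_n(x,y)=1$ iff $\sum_{i=1}^n(x_i\oplus y_i)\neq t$. Quantum communication model (Yao, no prior entanglement): Alice receives $x$, Bob $y$; each holds private qubits initialized to the input and $|0\rangle$; in each round one player applies a unitary to his qubits and sends one qubit; at the end a qubit is measured giving the output; the cost is the number of qubits exchanged. $BQC(f)$ is the minimum cost of a quantum protocol computing $f$ with error probability at most $1/3$ on every input. *)

(* Defs.v *)
From HB Require Import structures.
From mathcomp Require Import all_boot all_order all_algebra.
From mathcomp Require Import reals exp.
From mathcomp Require Import complex.
Set Implicit Arguments. Unset Strict Implicit. Unset Printing Implicit Defensive.
Import Order.TTheory GRing.Theory Num.Theory.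
Local Open Scope ring_scope.

(* Yao's quantum communication model (no prior entanglement).                *)
(* The whole system consists of N qubits, indexed by 'I_N; computational    *)
(* basis states are bit assignments {ffun 'I_N -> bool}; amplitudes live in  *)
(* the complex numbers R[i] over an arbitrary real field R : realType.       *)
(* At every moment each qubit is owned by exactly one player; the set of     *)
(* Alice's qubits is A, Bob's is its complement.                             *)

Definition bstate (N : nat) := {ffun 'I_N -> bool}.
Definition qstate (R : realType) (N : nat) := bstate N -> R[i].
Definition qop (R : realType) (N : nat) := bstate N -> bstate N -> R[i].

Definition qapply (R : realType) N (M : qop R N) (psi : qstate R N) : qstate R N :=
  fun z => \sum_(w : bstate N) M z w * psi w.

(* M is unitary: M M^dagger = I (equivalent to unitarity in finite dimension) *)
Definition unitary (R : realType) N (M : qop R N) : Prop :=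
  forall z z' : bstate N,
    \sum_(w : bstate N) M z w * conjc (M z' w) = ((z == z')%:R : R[i]).

Definition agree_on N (S : {set 'I_N}) (z w : bstate N) : bool :=
  [forall i in S, z i == w i].

(* M acts only on the qubits in S, i.e. M = U (x) Id for some operator U on
   the qubits of S and the identity on the remaining qubits. *)
Definition local_on (R : realType) N (S : {set 'I_N}) (M : qop R N) : Prop :=
  (forall z z', ~~ agree_on (~: S) z z' -> M z z' = 0) /\
  (forall z z' w w', agree_on S z w -> agree_on S z' w' ->
     agree_on (~: S) z z' -> agree_on (~: S) w w' -> M z z' = M w w').

Definition owned N (alice : bool) (A : {set 'I_N}) : {set 'I_N} :=
  if alice then A else ~: A.

(* One round: the player (Alice iff r_alice) applies the unitary r_U to his
   own qubits and then sends his qubit r_sent to the other player. *)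
Record round (R : realType) (N : nat) := Round {
  r_alice : bool;
  r_U : qop R N;
  r_sent : 'I_N }.

Definition next_owner (R : realType) N (A : {set 'I_N}) (r : round R N) :=
  if r_alice r then A :\ r_sent r else r_sent r |: A.

Fixpoint final_owner (R : realType) N (A : {set 'I_N}) (rs : seq (round R N))
  : {set 'I_N} :=
  if rs is r :: rs' then final_owner (next_owner A r) rs' else A.

Fixpoint legal_rounds (R : realType) N (A : {set 'I_N}) (rs : seq (round R N))
  : Prop :=
  if rs is r :: rs' then
    [/\ unitary (r_U r), local_on (owned (r_alice r) A) (r_U r),
        r_sent r \in owned (r_alice r) A & legal_rounds (next_owner A r) rs']
  else True.

Fixpoint run_rounds (R : realType) N (psi : qstate R N) (rs : seq (round R N))
  : qstate R N :=
  if rs is r :: rs' then run_rounds (qapply (r_U r) psi) rs' else psi.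

(* Inputs x, y are n-bit strings; the system has N = n + n + m qubits:
   qubits 0..n-1 hold x (owned by Alice), qubits n..2n-1 hold y (owned by
   Bob), and the m remaining qubits are workspace initialised to |0>, each
   initially owned by either player (as chosen by the protocol).
   After the rounds, one player may apply a last local unitary and then
   measures one of his qubits in the computational basis; that is the output. *)
Record protocol (R : realType) (n m : nat) := Protocol {
  p_initA : {set 'I_(n + n + m)};
  p_rounds : seq (round R (n + n + m));
  p_final_alice : bool;
  p_final_U : qop R (n + n + m);
  p_out : 'I_(n + n + m) }.

Definition protocol_legal (R : realType) n m (P : protocol R n m) : Prop :=
  let Af := final_owner (p_initA P) (p_rounds P) in
  [/\ forall i : 'I_(n + n + m), (i < n)%N -> i \in p_initA P,
      forall i : 'I_(n + n + m), (n <= i < n + n)%N -> i \notin p_initA P,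
      legal_rounds (p_initA P) (p_rounds P),
      unitary (p_final_U P) /\ local_on (owned (p_final_alice P) Af) (p_final_U P)
    & p_out P \in owned (p_final_alice P) Af].

Definition cost (R : realType) n m (P : protocol R n m) : nat := size (p_rounds P).

Definition init_bits n m (x y : n.-tuple bool) : bstate (n + n + m) :=
  [ffun i : 'I_(n + n + m) =>
     if (i < n)%N then nth false x i
     else if (i < n + n)%N then nth false y (i - n) else false].

Definition init_state (R : realType) n m (x y : n.-tuple bool) : qstate R (n + n + m) :=
  fun z => ((z == @init_bits n m x y)%:R : R[i]).

Definition final_state (R : realType) n m (P : protocol R n m) (x y : n.-tuple bool)
  : qstate R (n + n + m) :=
  qapply (p_final_U P) (run_rounds (@init_state R n m x y) (p_rounds P)).

Definition normsq (R : realType) (c : R[i]) : R :=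
  let: Complex a b := c in a ^+ 2 + b ^+ 2.

Definition prob_out (R : realType) n m (P : protocol R n m) (x y : n.-tuple bool)
  (b : bool) : R :=
  \sum_(z : bstate (n + n + m) | z (p_out P) == b) normsq (final_state P x y z).

Definition computes (R : realType) n m (P : protocol R n m)
  (f : n.-tuple bool -> n.-tuple bool -> bool) : Prop :=
  protocol_legal P /\
  forall x y : n.-tuple bool, 2 / 3 <= prob_out P x y (f x y).

Definition ham_dist n (x y : n.-tuple bool) : nat :=
  \sum_(i < n) ((tnth x i != tnth y i) : nat).

Definition HAM (n t : nat) (x y : n.-tuple bool) : bool := ham_dist x y != t.

(* Main.v *)
(* After C exchanged qubits the joint state is a sum of 2^C products of an
   Alice part depending on x and a Bob part depending on y, so the acceptance
   probabilities form a sum of O(4^C) rank-one matrices f(x) g(y) with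
   |f|, |g| <= 1.  A majority vote over d = O(log n) runs, taken directly on
   these matrices, yields 2^(O(C log n)) rank-one terms approximating the
   indicator of dist(x, y) = n/2 with polynomially small error.  Pair this
   approximation with Phi(x, y) = sum_(|s| = k) chi_s(x) chi_s(y), where k is
   the even number among n/2 and n/2 - 1.  By Parseval every rank-one term
   contributes at most 4^n, and the error is controlled by the L1 norm of Phi,
   at most 2^n 2^(n/2) per row.  The indicator itself contributes
   2^n C(n, k) times a central Krawtchouk value of order C(k, k/2), which is
   2^(2n) 2^(n/2) up to a polynomial factor.  Hence 2^(O(C log n)) is at least
   2^(n/2) / poly(n). *)

Require Import Defs.
From HB Require Import structures.
From mathcomp Require Import all_boot all_order all_algebra.
From mathcomp Require Import reals exp.
From mathcomp Require Import complex.
From mathcomp Require Import ring lra zify.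
Set Implicit Arguments. Unset Strict Implicit. Unset Printing Implicit Defensive.
Import Order.TTheory GRing.Theory Num.Theory.
Local Open Scope ring_scope.

Local Notation Re := complex.Re.
Local Notation Im := complex.Im.

(** * Characters and the level-k kernel on the Boolean cube *)

Lemma card_bstate n : #|{: bstate n}| = (2 ^ n)%N.
Proof. by rewrite card_ffun card_bool card_ord. Qed.

Section Fourier.
Variables (R : realFieldType) (n : nat).
Implicit Types (s x y : bstate n) (f : bstate n -> R).

Definition weight s : nat := \sum_i (s i : nat).
Definition dist x y : nat := \sum_i ((x i != y i) : nat).
Definition chi s x : R := \prod_i (-1) ^+ (s i && x i).

Lemma subn_weight s : (n - weight s = \sum_i (~~ s i : nat))%N.
Proof.
have : (\sum_(i < n) ((s i : nat) + (~~ s i : nat)) = n)%N.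
  rewrite (eq_bigr (fun=> 1%N)) => [|i _]; last by case: (s i).
  by rewrite sum1_card card_ord.
by rewrite big_split /= -/(weight s) => nE; rewrite -[X in (X - _)%N]nE addKn.
Qed.

Lemma weight_le s : (weight s <= n)%N.
Proof.
rewrite -[X in (_ <= X)%N]card_ord -sum1_card.
by apply: leq_sum => i _; case: (s i).
Qed.

Lemma chiC s x : chi s x = chi x s.
Proof. by apply: eq_bigr => i _; rewrite andbC. Qed.

Lemma chi_orthogonal x y :
  \sum_s chi s x * chi s y = (x == y)%:R * 2 ^+ n.
Proof.
pose F i b : R := (-1) ^+ (b && x i) * (-1) ^+ (b && y i).
under eq_bigr do rewrite /chi -big_split /=.
rewrite -(bigA_distr_bigA F).
have FE i : \sum_b F i b = (x i == y i)%:R * 2.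
  by rewrite big_bool /F /=; case: (x i); case: (y i); rewrite /= ?expr0 ?expr1; ring.
under eq_bigr do rewrite FE.
rewrite big_split /= prodr_const card_ord; congr (_ * _).
have [-> | /eqP neq] := eqVneq x y; first by rewrite big1 // => i _; rewrite eqxx.
have [i neqi] : exists i, x i != y i.
  apply/existsP; apply: contra_notT neq; rewrite negb_exists => /forallP eqxy.
  by apply/ffunP => i; apply/eqP; move: (eqxy i); rewrite negbK.
by rewrite (bigD1 i) //= (negbTE neqi) mul0r.
Qed.

Lemma parseval f :
  \sum_s (\sum_x f x * chi s x) ^+ 2 = 2 ^+ n * \sum_x f x ^+ 2.
Proof.
have E s : (\sum_x f x * chi s x) ^+ 2 =
    \sum_x \sum_y f x * f y * (chi s x * chi s y).
  rewrite expr2 big_distrl; apply: eq_bigr => x _ /=.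
  by rewrite big_distrr; apply: eq_bigr => y _ /=; ring.
under eq_bigr do rewrite E.
rewrite exchange_big /= mulr_sumr; apply: eq_bigr => x _.
rewrite exchange_big /= (bigD1 x) //= -mulr_sumr chi_orthogonal eqxx.
rewrite big1 => [|y neq]; first by rewrite mul1r addr0; ring.
by rewrite -mulr_sumr chi_orthogonal eq_sym (negbTE neq) mul0r mulr0.
Qed.

(** The sum over [y] factors over coordinates. The product of the two characters is -1 to the number
    of differing positions inside [s], so a coordinate contributes 1 - X if it lies in [s] and 1 + X
    otherwise. *)
Lemma chi_generating s x :
  \sum_y (chi s x * chi s y)%:P * 'X^(dist x y) =
  (1 - 'X) ^+ weight s * (1 + 'X) ^+ (n - weight s) :> {poly R}.
Proof.
pose F i b : {poly R} :=
  ((-1) ^+ (s i && x i) * (-1) ^+ (s i && b))%:P * 'X^(x i != b).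
have E y : (chi s x * chi s y)%:P * 'X^(dist x y) = \prod_i F i (y i).
  by rewrite big_split /= expr_sum -rmorph_prod big_split.
under eq_bigr do rewrite E.
rewrite -(bigA_distr_bigA F).
rewrite subn_weight !expr_sum -big_split; apply: eq_bigr => i _ /=.
by rewrite big_bool /F; case: (s i); case: (x i);
  rewrite /= ?expr0 ?expr1 ?mulrNN ?mulr1 ?mul1r ?polyCN polyC1; ring.
Qed.

(** The right-hand side is a Krawtchouk value: the eigenvalue at [chi s] of the adjacency operator
    of distance [h]. *)
Lemma sum_chi_sphere s x h :
  \sum_y (dist x y == h)%:R * (chi s x * chi s y) =
  ((1 - 'X) ^+ weight s * (1 + 'X) ^+ (n - weight s) : {poly R})`_h.
Proof.
rewrite -(chi_generating s x) coef_sum; apply: eq_bigr => y _.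
by rewrite coefCM coefXn mulrC eq_sym.
Qed.

Lemma card_weight k : #|[pred s | weight s == k]| = 'C(n, k).
Proof.
rewrite -[n in 'C(n, k)]card_ord -card_draws -2!sum1_card.
rewrite (reindex (fun A : {set 'I_n} => [ffun i => i \in A] : bstate n)) /=.
  apply: eq_bigl => A; rewrite !inE /weight; congr (_ == _).
  rewrite -sum1_card [RHS]big_mkcond; apply: eq_bigr => i _.
  by rewrite ffunE; case: (i \in A).
exists (fun s => [set i | s i]) => [A | s] _.
  by apply/setP => i; rewrite inE ffunE.
by apply/ffunP => i; rewrite ffunE inE.
Qed.

(** This is 2^n times the kernel of the orthogonal projection onto the span of the characters of
    weight [k]. *)
Definition level_kernel k x y : R := \sum_(s | weight s == k) chi s x * chi s y.

(** The Fourier coefficients of a row are 0 or ±1, so Parseval bounds its sum of squares by 4^n.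
    Passing to the L1 norm over 2^n entries gives the factor 2^(n/2). *)
Lemma sum_abs_level_kernel k h x : n = h.*2 ->
  \sum_y `|level_kernel k x y| <= 2 ^+ n * 2 ^+ h.
Proof.
move=> nh; have h0 : 0 < 2 ^+ h :> R by rewrite exprn_gt0.
pose d s : R := (weight s == k)%:R * chi s x.
have KE y : level_kernel k x y = \sum_s d s * chi y s.
  by rewrite /level_kernel big_mkcond; apply: eq_bigr => s _; rewrite /d [chi y s]chiC;
    case: ifP => _; rewrite ?mul1r ?mul0r.
have chi2 s : chi s x ^+ 2 = 1.
  rewrite expr2 -big_split big1 // => i _ /=.
  by case: (_ && _); rewrite ?expr0 ?expr1; ring.
have S2 : \sum_y level_kernel k x y ^+ 2 <= 2 ^+ n * 2 ^+ n.
  under eq_bigr do rewrite KE.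
  rewrite parseval ler_pM2l ?exprn_gt0 //.
  apply: (@le_trans _ _ (\sum_(s : bstate n) 1)).
    apply: ler_sum => s _; rewrite /d exprMn chi2.
    by case: (_ == _) => /=; rewrite ?expr1n ?expr0n /= ?mul0r ?mul1r ?ler01.
  by rewrite sumr_const card_bstate natrX.
(* AM-GM: |u| <= (2^h + u^2 / 2^h) / 2 *)
have amgm (u : R) : `|u| <= 2^-1 * (2 ^+ h + u ^+ 2 / 2 ^+ h).
  rewrite -subr_ge0 -(pmulr_rge0 _ h0) -(real_normK (num_real u)).
  have -> : 2 ^+ h * (2^-1 * (2 ^+ h + `|u| ^+ 2 / 2 ^+ h) - `|u|)
     = 2^-1 * (2 ^+ h - `|u|) ^+ 2 :> R by field; apply: lt0r_neq0.
  by rewrite mulr_ge0 ?sqr_ge0 // invr_ge0.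
apply: le_trans (ler_sum _ (fun y _ => amgm (level_kernel k x y))) _.
rewrite -mulr_sumr big_split /= sumr_const card_bstate -mulr_suml.
have : (\sum_y level_kernel k x y ^+ 2) / 2 ^+ h <= 2 ^+ n * 2 ^+ h.
  by rewrite ler_pdivrMr // -mulrA -exprD addnn -nh.
by rewrite -[X in X + _]mulr_natr natrX; lra.
Qed.

(** Expanding the kernel turns the pairing into a sum over level [k] of products of Fourier
    coefficients of [f] and [g]. Extending to all levels and applying Parseval to each function
    bounds it. *)
Lemma rank_one_level_kernel (f g : bstate n -> R) k :
  (forall x, `|f x| <= 1) -> (forall y, `|g y| <= 1) ->
  `|\sum_x \sum_y f x * g y * level_kernel k x y| <= 2 ^+ n * 2 ^+ n.
Proof.
move=> f1 g1; pose fh s := \sum_x f x * chi s x; pose gh s := \sum_y g y * chi s y.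
have -> : \sum_x \sum_y f x * g y * level_kernel k x y =
    \sum_(s | weight s == k) fh s * gh s.
  under eq_bigr do under eq_bigr do rewrite mulr_sumr.
  under eq_bigr do rewrite exchange_big.
  rewrite exchange_big; apply: eq_bigr => s _ /=.
  rewrite /fh big_distrl; apply: eq_bigr => x _ /=.
  by rewrite /gh big_distrr; apply: eq_bigr => y _ /=; ring.
have amgm (u v : R) : `|u * v| <= 2^-1 * u ^+ 2 + 2^-1 * v ^+ 2.
  have /andP[p m] : (0 <= (u - v) ^+ 2) && (0 <= (u + v) ^+ 2) by rewrite !sqr_ge0.
  by rewrite ler_norml; apply/andP; split; nra.
have bound e : (forall x, `|e x| <= 1) ->
    \sum_s (\sum_x e x * chi s x) ^+ 2 <= 2 ^+ n * 2 ^+ n.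
  move=> e1; rewrite parseval ler_pM2l ?exprn_gt0 //.
  apply: (@le_trans _ _ (\sum_(s : bstate n) 1)).
    by apply: ler_sum => x _; rewrite -(real_normK (num_real _)) exprn_ile1.
  by rewrite sumr_const card_bstate natrX.
apply: le_trans (ler_norm_sum _ _ _) _.
apply: (@le_trans _ _ (\sum_s (2^-1 * fh s ^+ 2 + 2^-1 * gh s ^+ 2))).
  rewrite big_mkcond; apply: ler_sum => s _; case: ifP => _; first exact: amgm.
  by rewrite addr_ge0 // mulr_ge0 ?invr_ge0 ?sqr_ge0.
rewrite big_split /= -!mulr_sumr.
by have := bound _ f1; have := bound _ g1; rewrite -/fh -/gh; lra.
Qed.

Lemma coef_1subX m j : ((1 - 'X) ^+ m : {poly R})`_j = (-1) ^+ j * 'C(m, j)%:R.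
Proof.
rewrite exprBn coef_sum.
have E i : ((-1) ^+ i * 1 ^+ (m - i) * 'X^i *+ 'C(m, i) : {poly R})`_j =
    (if i == j then (-1) ^+ j * 'C(m, j)%:R else 0).
  rewrite expr1n mulr1 -mulr_natr -polyC_natr coefMC -polyC1 -polyCN -polyC_exp.
  by rewrite coefCM coefXn eq_sym; case: eqP => [->|_]; rewrite ?mulr1 ?mulr0 ?mul0r.
under eq_bigr do rewrite E.
rewrite -big_mkcond (big_ord1_eq _ (fun=> (-1) ^+ j * 'C(m, j)%:R)) ltnS.
by case: leqP => // lt_mj; rewrite bin_small ?mulr0.
Qed.

(** The common part of the product is (1 - X^2)^(2q), which has only even powers and central
    coefficient ±C(2q, q). If [r] holds, the extra factor is 1 + 2X + X^2 and the index is odd, so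
    only the term 2X contributes and the value doubles. *)
Lemma coef_krawtchouk q (r : bool) :
  `|((1 - 'X) ^+ q.*2 * (1 + 'X) ^+ (q.*2 + r.*2) : {poly R})`_(q.*2 + r)| =
  (r.+1 * 'C(q.*2, q))%:R.
Proof.
pose P : {poly R} := (1 - 'X) ^+ q.*2 \Po 'X^2.
have PE : (1 - 'X) ^+ q.*2 * (1 + 'X) ^+ q.*2 = P.
  rewrite -exprMn /P rmorphXn /= rmorphB /= comp_polyX -polyC1 comp_polyC polyC1.
  by congr (_ ^+ _); ring.
have Pq : `|P`_q.*2| = 'C(q.*2, q)%:R.
  rewrite /P coef_comp_poly_Xn // dvdn2 odd_double -muln2 mulnK // coef_1subX.
  by rewrite normrM normrX normrN1 expr1n mul1r normr_nat.
have Podd i : odd i -> P`_i = 0.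
  by rewrite /P coef_comp_poly_Xn // dvdn2 => ->.
rewrite exprD mulrA PE; case: r => /=; last by rewrite mulr1 addn0 mul1n.
have -> : (1 + 'X) ^+ 1.*2 = 1 + 2%:P * 'X + 'X^2 :> {poly R} by ring.
rewrite !mulrDr mulr1 mulrCA !coefD coefCM coefMX coefMXn addn1 /=.
rewrite Podd /= ?odd_double // add0r [X in _ + X](_ : _ = 0).
  by rewrite addr0 normrM normr_nat Pq natrM.
case: ifP => // /negbT; rewrite -leqNgt => lt1.
by rewrite Podd // oddB //= odd_double.
Qed.

End Fourier.

(** A duality argument with the level kernel as witness: its pairing with the sphere indicator is
    known exactly, its pairing with [M] is small when there are few terms, and its pairing with the
    error is controlled by the L1 norm of the rows. *)
Lemma binom_le_terms (R : realFieldType) q (r : bool) h n (I : finType)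
    (f g : I -> bstate n -> R) (M : bstate n -> bstate n -> R) (eps : R) :
  h = (q.*2 + r)%N -> n = h.*2 ->
  (forall i x, `|f i x| <= 1) -> (forall i y, `|g i y| <= 1) ->
  (forall x y, M x y = \sum_i f i x * g i y) ->
  (forall x y, `|M x y - (dist x y == h)%:R| <= eps) ->
  ('C(n, q.*2) * 'C(q.*2, q))%:R <= 2 ^+ n * (#|I|%:R + eps * 2 ^+ h).
Proof.
move=> hE nE f1 g1 ME Mh; set k := q.*2; pose K := @level_kernel R n k.
have N0 : 0 < 2 ^+ n :> R by rewrite exprn_gt0.
have upper : `|\sum_x \sum_y M x y * K x y| <= #|I|%:R * (2 ^+ n * 2 ^+ n).
  have -> : \sum_x \sum_y M x y * K x y =
      \sum_i \sum_x \sum_y f i x * g i y * K x y.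
    rewrite [RHS]exchange_big; apply: eq_bigr => x _ /=.
    by rewrite exchange_big; apply: eq_bigr => y _ /=; rewrite ME mulr_suml.
  apply: le_trans (ler_norm_sum _ _ _) _.
  apply: le_trans (ler_sum _ (fun i _ => rank_one_level_kernel k (f1 i) (g1 i))) _.
  by rewrite sumr_const mulr_natl lexx.
have main : `|\sum_x \sum_y (dist x y == h)%:R * K x y| =
    2 ^+ n * ('C(n, k) * (r.+1 * 'C(k, q)))%:R.
  set c := ((1 - 'X) ^+ q.*2 * (1 + 'X) ^+ (q.*2 + r.*2) : {poly R})`_(q.*2 + r).
  have E x : \sum_y (dist x y == h)%:R * K x y = 'C(n, k)%:R * c.
    under eq_bigr do rewrite mulr_sumr.
    rewrite exchange_big /= -card_weight.
    rewrite (eq_bigr (fun=> c)) => [|s /eqP sk]; first by rewrite sumr_const mulr_natl.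
    rewrite sum_chi_sphere sk /c -hE /k; congr (nth 0 (polyseq (_ * _ ^+ _)) _); lia.
  under eq_bigr do rewrite E.
  rewrite sumr_const card_bstate -[X in `|X|]mulr_natl natrX.
  rewrite normrM normrX normrM !normr_nat.
  by rewrite coef_krawtchouk -natrM.
have err : `|\sum_x \sum_y (M x y - (dist x y == h)%:R) * K x y| <=
    eps * (2 ^+ n * (2 ^+ n * 2 ^+ h)).
  apply: le_trans (ler_norm_sum _ _ _) _.
  apply: (@le_trans _ _ (\sum_(x : bstate n) eps * (2 ^+ n * 2 ^+ h))).
    apply: ler_sum => x _; apply: le_trans (ler_norm_sum _ _ _) _.
    have eps0 : 0 <= eps := le_trans (normr_ge0 _) (Mh x x).
    apply: le_trans (ler_wpM2l eps0 (@sum_abs_level_kernel R n k h x nE)).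
    by rewrite mulr_sumr; apply: ler_sum => y _; rewrite normrM ler_wpM2r.
  by rewrite sumr_const card_bstate -[X in X <= _]mulr_natl natrX mulrCA.
have split : \sum_x \sum_y (dist x y == h)%:R * K x y =
    \sum_x \sum_y M x y * K x y -
    \sum_x \sum_y (M x y - (dist x y == h)%:R) * K x y.
  rewrite -sumrB; apply: eq_bigr => x _; rewrite -sumrB.
  by apply: eq_bigr => y _ /=; rewrite -mulrBl subKr.
rewrite -(ler_pM2l N0).
apply: (@le_trans _ _ (2 ^+ n * ('C(n, k) * (r.+1 * 'C(k, q)))%:R)).
  by rewrite ler_pM2l // ler_nat leq_mul2l leq_pmull ?orbT.
rewrite -main split.
apply: le_trans (ler_normB _ _) _.
apply: le_trans (lerD upper err) _.
by rewrite le_eqVlt; apply/orP; left; apply/eqP; ring.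
Qed.

(** * Real and imaginary parts of complex numbers *)

Section ComplexParts.
Variable R : realType.
Implicit Types u v : R[i].

Lemma ReM u v : Re (u * v) = Re u * Re v - Im u * Im v.
Proof. by case: u v => [a b] [c d]. Qed.

Lemma Re_sum (I : finType) (P : pred I) (F : I -> R[i]) :
  Re (\sum_(i | P i) F i) = \sum_(i | P i) Re (F i).
Proof. by apply: (big_morph (@Re R)) => [[a b] [c d]|]. Qed.

Lemma Im_sum (I : finType) (P : pred I) (F : I -> R[i]) :
  Im (\sum_(i | P i) F i) = \sum_(i | P i) Im (F i).
Proof. by apply: (big_morph (@Im R)) => [[a b] [c d]|]. Qed.

Lemma normsq_ge0 u : 0 <= normsq u.
Proof. by case: u => a b /=; rewrite addr_ge0 ?sqr_ge0. Qed.

Lemma normsqE u : normsq u = Re (u * conjc u).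
Proof. by case: u => a b /=; ring. Qed.

Lemma normsq_bool (b : bool) u : normsq (b%:R * u) = b%:R * normsq u.
Proof. by case: b; rewrite ?mul1r // !mul0r /= expr0n addr0. Qed.

Lemma Re_mul_conj_le u v : `|Re (u * conjc v)| <= 2^-1 * (normsq u + normsq v).
Proof.
case: u v => [a b] [c d] /=; have := (sqr_ge0 (a - c), sqr_ge0 (a + c)).
have := (sqr_ge0 (b - d), sqr_ge0 (b + d)).
by move=> [? ?] [? ?]; rewrite ler_norml; apply/andP; split; nra.
Qed.

Lemma Im_mul_conj_le u v : `|Im (u * conjc v)| <= 2^-1 * (normsq u + normsq v).
Proof.
case: u v => [a b] [c d] /=; have := (sqr_ge0 (a - d), sqr_ge0 (a + d)).
have := (sqr_ge0 (b - c), sqr_ge0 (b + c)).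
by move=> [? ?] [? ?]; rewrite ler_norml; apply/andP; split; nra.
Qed.

End ComplexParts.

(** * Functions of a subset of the qubits *)

Section Dependence.
Variable N : nat.
Implicit Types (S : {set 'I_N}) (z w : bstate N).

Definition depends_on T S (f : bstate N -> T) : Prop :=
  forall z w, agree_on S z w -> f z = f w.

Lemma agree_onP S z w : reflect {in S, z =1 w} (agree_on S z w).
Proof. exact: 'forall_in_eqP. Qed.

Definition mix S z w : bstate N := [ffun i => if i \in S then z i else w i].

(** Exchanging the coordinates outside [S] between the two states of a pair is an involution; it
    turns f(z) g(w) into f and g at one common state. The other state is then free, whence the
    factor 2^N. *)
Lemma sumM_depends (C : comRingType) S (f g : bstate N -> C) :
  depends_on S f -> depends_on (~: S) g ->
  (\sum_z f z) * (\sum_z g z) = 2 ^+ N * \sum_z f z * g z.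
Proof.
move=> fS gS; pose h p := (mix S p.1 p.2, mix S p.2 p.1) : bstate N * bstate N.
have hK : involutive h.
  by move=> [z w]; congr (_, _); apply/ffunP => i; rewrite !ffunE; case: (i \in S).
transitivity (\sum_(p : bstate N * bstate N) f p.1 * g p.1); last first.
  rewrite -(pair_big xpredT xpredT (fun z w => f z * g z)) /= mulr_sumr.
  by apply: eq_bigr => z _; rewrite sumr_const card_bstate -[LHS]mulr_natl natrX.
rewrite big_distrl [RHS](reindex_inj (inv_inj hK)) /=.
under eq_bigr do rewrite mulr_sumr.
rewrite pair_big; apply: eq_bigr => -[z w] _ /=; congr (_ * _).
  by apply: fS; apply/agree_onP => i iS; rewrite ffunE iS.
by apply: gS; apply/agree_onP => i; rewrite inE ffunE => /negbTE ->.
Qed.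

Definition flip (q : 'I_N) z : bstate N := [ffun i => (i == q) (+) z i].
Definition setbit (q : 'I_N) (b : bool) z : bstate N :=
  [ffun i => if i == q then b else z i].

Lemma flipK q : involutive (flip q).
Proof. by move=> z; apply/ffunP => i; rewrite !ffunE; case: (i == q); case: (z i). Qed.

Lemma setbit_id q z : setbit q (z q) z = z.
Proof. by apply/ffunP => i; rewrite ffunE; case: eqP => [->|]. Qed.

Lemma setbit_flip q b z : setbit q b (flip q z) = setbit q b z.
Proof. by apply/ffunP => i; rewrite !ffunE; case: (i == q). Qed.

Lemma sum_flip (V : zmodType) (q : 'I_N) b (F : bstate N -> V) :
  \sum_z F z = \sum_(z : bstate N | z q == b) (F z + F (flip q z)).
Proof.
rewrite big_split (bigID (fun z : bstate N => z q == b)) /=; congr (_ + _).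
rewrite (reindex_inj (inv_inj (flipK q))); apply: eq_bigl => z.
by rewrite ffunE eqxx; case: b; case: (z q).
Qed.

End Dependence.

(** * Unitary and local operators *)

Section Operators.
Variables (R : realType) (N : nat).
Implicit Types (S : {set 'I_N}) (M : qop R N) (a b : qstate R N).

(** [unitary] gives orthonormal rows. Enumerating the basis states yields a square matrix, whose
    right inverse is also a left inverse. *)
Lemma unitary_cols M : unitary M ->
  forall w w', \sum_z M z w * conjc (M z w') = (w == w')%:R.
Proof.
move=> uM w w'.
pose A : 'M[R[i]]_#|bstate N| := \matrix_(i, j) M (enum_val i) (enum_val j).
pose B : 'M[R[i]]_#|bstate N| := \matrix_(i, j) conjc (M (enum_val j) (enum_val i)).
have AB : A *m B = 1%:M.
  apply/matrixP => i j; rewrite !mxE -(inj_eq enum_val_inj) -uM.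
  rewrite (reindex (@enum_val _ (bstate N))) /=; last by apply: onW_bij; exact: enum_val_bij.
  by apply: eq_bigr => k _; rewrite !mxE.
have /matrixP /(_ (enum_rank w') (enum_rank w)) := mulmx1C AB.
rewrite !mxE (inj_eq enum_rank_inj) eq_sym => <-.
rewrite (reindex (@enum_val _ (bstate N))) /=; last by apply: onW_bij; exact: enum_val_bij.
by apply: eq_bigr => k _; rewrite !mxE !enum_rankK mulrC.
Qed.

Lemma unitary_normsq M a : unitary M ->
  \sum_z normsq (qapply M a z) = \sum_z normsq (a z).
Proof.
move=> uM; under eq_bigr do rewrite normsqE; under [RHS]eq_bigr do rewrite normsqE.
rewrite -!Re_sum; congr Re; rewrite /qapply.
transitivity (\sum_z \sum_w \sum_w' (a w * conjc (a w')) * (M z w * conjc (M z w'))).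
  apply: eq_bigr => z _; rewrite rmorph_sum big_distrl; apply: eq_bigr => w _ /=.
  by rewrite big_distrr; apply: eq_bigr => w' _ /=; rewrite rmorphM /=; ring.
rewrite exchange_big; apply: eq_bigr => w _ /=.
rewrite exchange_big (bigD1 w) //= -mulr_sumr unitary_cols // eqxx mulr1.
rewrite big1 ?addr0 // => w' neq.
by rewrite -mulr_sumr unitary_cols // eq_sym (negbTE neq) mulr0.
Qed.

Lemma local_depends S M a :
  local_on S M -> depends_on S a -> depends_on S (qapply M a).
Proof.
move=> [M0 Meq] aS z z' zz'.
(* the involution carries the fibre over z|~S to the fibre over z'|~S *)
pose h (w : bstate N) : bstate N :=
  [ffun i => if i \in S then w i else w i (+) (z i (+) z' i)].
have hK : involutive h.
  move=> w; apply/ffunP => i; rewrite !ffunE; case: (i \in S) => //.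
  by rewrite -addbA addbb addbF.
have hS w : agree_on S w (h w) by apply/agree_onP => i iS; rewrite ffunE iS.
have hC w : agree_on (~: S) z' (h w) = agree_on (~: S) z w.
  apply: eq_forallb => i; rewrite inE ffunE; case: ifP => //= _.
  by case: (z i); case: (z' i); case: (w i).
rewrite /qapply [RHS](reindex_inj (inv_inj hK)); apply: eq_bigr => w _.
rewrite -(aS _ _ (hS w)); congr (_ * _).
have [zw|zw] := boolP (agree_on (~: S) z w); last by rewrite !M0 ?hC.
by apply: Meq; rewrite ?hC.
Qed.

Lemma local_mul S M a b z : local_on S M -> depends_on (~: S) b ->
  qapply M (fun w => a w * b w) z = qapply M a z * b z.
Proof.
move=> [M0 _] bS; rewrite /qapply mulr_suml; apply: eq_bigr => w _.
have [zw|zw] := boolP (agree_on (~: S) z w); last by rewrite M0 // !mul0r.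
by rewrite (bS _ _ zw) mulrA.
Qed.

End Operators.

(** * Decomposition of the joint state into products *)

Section Split.
Variables (R : realType) (N : nat).
Implicit Types (S A : {set 'I_N}) (K : nat) (q : 'I_N).

(* a_i ignores the qubits outside S, so its sum over all basis states counts
   every amplitude 2^|~S| times; s and t absorb these multiplicities. *)
Definition split_state (X Y : Type) (S : {set 'I_N}) (K : nat)
    (psi : X -> Y -> qstate R N) : Prop :=
  exists (I : finType) (a : I -> X -> qstate R N) (b : I -> Y -> qstate R N)
    (s : X -> R) (t : Y -> R),
  [/\ #|I| = K,
      forall i x, depends_on S (a i x) /\ \sum_z normsq (a i x z) <= s x,
      forall i y, depends_on (~: S) (b i y) /\ \sum_z normsq (b i y z) <= t y,
      [/\ forall x, 0 < s x, forall y, 0 < t y & forall x y, s x * t y = 2 ^+ N]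
    & forall x y z, psi x y z = \sum_i a i x z * b i y z].

(** Reduces every step by Bob to the same step by Alice. *)
Lemma split_swap X Y S K (psi : X -> Y -> qstate R N) :
  split_state S K psi -> split_state (~: S) K (fun y x => psi x y).
Proof.
move=> [I [a [b [s [t [cI Pa Pb [s0 t0 st] E]]]]]]; exists I, b, a, t, s; split=> //.
- by rewrite setCK.
- by split=> // y x; rewrite mulrC.
by move=> y x z; rewrite E; apply: eq_bigr => i _; rewrite mulrC.
Qed.

Lemma split_unitary X Y S K (psi : X -> Y -> qstate R N) (U : qop R N) :
  unitary U -> local_on S U -> split_state S K psi ->
  split_state S K (fun x y => qapply U (psi x y)).
Proof.
move=> uU lU [I [a [b [s [t [cI Pa Pb [s0 t0 st] E]]]]]].
exists I, (fun i x => qapply U (a i x)), b, s, t; split=> //.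
  move=> i x; have [dep le_s] := Pa i x; split; first exact: local_depends.
  by rewrite unitary_normsq.
move=> x y z; rewrite /qapply; under eq_bigr do rewrite E mulr_sumr.
rewrite exchange_big; apply: eq_bigr => i _ /=.
by rewrite -(local_mul _ _ lU (proj1 (Pb i y))).
Qed.

(** Each term splits according to the value [c] of the sent qubit: Alice's factor has the qubit
    fixed to [c], and Bob's factor is multiplied by the indicator of [c]. Alice's factor now ignores
    [q], which doubles its multiplicity bound; Bob's old factor ignored [q], so the indicator halves
    his. The product of the bounds stays 2^N. *)
Lemma split_send X Y S K (psi : X -> Y -> qstate R N) q :
  q \in S -> split_state S K psi -> split_state (S :\ q) (K * 2) psi.
Proof.
move=> qS [I [a [b [s [t [cI Pa Pb [s0 t0 st] E]]]]]].
exists (I * bool)%type, (fun p x z => a p.1 x (setbit q p.2 z)),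
  (fun p y (z : bstate N) => (z q == p.2)%:R * b p.1 y z), (fun x => 2 * s x), (fun y => t y / 2).
split.
- by rewrite card_prod cI card_bool.
- move=> [i c] x /=; have [dep le_s] := Pa i x; split.
    move=> z w zw; apply: dep; apply/agree_onP => j jS; rewrite !ffunE.
    by case: eqVneq => // neq; apply/(agree_onP _ _ _ zw); rewrite !inE neq.
  rewrite (sum_flip q c) /=.
  have -> : \sum_(z : bstate N | z q == c)
      (normsq (a i x (setbit q c z)) + normsq (a i x (setbit q c (flip q z)))) =
      2 * \sum_(z : bstate N | z q == c) normsq (a i x z).
    rewrite mulr_sumr; apply: eq_bigr => z /eqP <-.
    by rewrite setbit_flip setbit_id; ring.
  rewrite ler_pM2l //; apply: le_trans le_s.
  rewrite [X in _ <= X](bigID (fun z : bstate N => z q == c)) /= lerDl.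
  by apply: sumr_ge0 => z _; exact: normsq_ge0.
- move=> [i c] y /=; have [dep le_t] := Pb i y; split.
    move=> z w zw; rewrite (_ : z q = w q).
      congr (_ * _); apply: dep; apply/agree_onP => j; rewrite inE => jS.
      by apply/(agree_onP _ _ _ zw); rewrite !inE (negbTE jS) andbF.
    by apply/(agree_onP _ _ _ zw); rewrite !inE eqxx.
  rewrite ler_pdivlMr //; apply: le_trans le_t.
  rewrite [X in _ <= X](sum_flip q c) mulr_suml.
  under eq_bigr do rewrite normsq_bool.
  rewrite (bigID (fun z : bstate N => z q == c)) /= [X in _ + X]big1 ?addr0.
    apply: ler_sum => z zc; rewrite zc mul1r.
    rewrite (dep (flip q z) z); first by lra.
    apply/agree_onP => j; rewrite inE ffunE => jS.
    by case: eqP jS => [->|//]; rewrite qS.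
  by move=> z /negbTE ->; rewrite !mul0r.
- split=> [x|y|x y]; [by rewrite mulr_gt0 | by rewrite divr_gt0 |].
  by rewrite -(st x y); field.
move=> x y z; rewrite E.
rewrite -(pair_big xpredT xpredT
   (fun i c => a i x (setbit q c z) * ((z q == c)%:R * b i y z))) /=.
apply: eq_bigr => i _; rewrite (bigD1 (z q)) //= eqxx setbit_id mul1r big1 ?addr0 //.
by move=> c; rewrite eq_sym => /negbTE ->; rewrite mul0r mulr0.
Qed.

Lemma split_run X Y A K (psi : X -> Y -> qstate R N) (rs : seq (round R N)) :
  split_state A K psi -> legal_rounds A rs ->
  split_state (final_owner A rs) (K * 2 ^ size rs)
    (fun x y => run_rounds (psi x y) rs).
Proof.
elim: rs A K psi => [|r rs IH] A K psi Hpsi /=; first by rewrite muln1.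
case=> uU lU qS /IH; rewrite expnS mulnA; apply.
rewrite /next_owner; case: (r_alice r) uU lU qS => uU lU qS.
  by apply: split_send => //; exact: split_unitary.
move: Hpsi => /split_swap /(split_unitary uU lU) /(split_send qS) /split_swap.
by rewrite setCD setCK setUC.
Qed.

Definition bounded_terms (X Y : Type) (J : finType) (f : J -> X -> R)
    (g : J -> Y -> R) (M : X -> Y -> R) : Prop :=
  [/\ forall j x, `|f j x| <= 1, forall j y, `|g j y| <= 1
    & forall x y, M x y = \sum_j f j x * g j y].

(** Expanding the squared modulus gives K^2 pairs of terms, and [sumM_depends] factors each into an
    Alice sum and a Bob sum. The real part of their product is Re Re - Im Im, which doubles the
    number of terms. Division by [s x] and [t y] bounds the factors by 1 and cancels 2^N. *)
Lemma split_measure X Y S K (psi : X -> Y -> qstate R N) q :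
  q \in S -> split_state S K psi ->
  exists (J : finType) (f : bool -> J -> X -> R) (g : bool -> J -> Y -> R),
    #|J| = (K * K * 2)%N /\
    forall c, bounded_terms (f c) (g c)
      (fun x y => \sum_(z : bstate N | z q == c) normsq (psi x y z)).
Proof.
move=> qS [I [a [b [s [t [cI Pa Pb [s0 t0 st] E]]]]]].
(* The measured qubit belongs to [S], so the outcome indicator goes into Alice's factor. *)
pose u (c : bool) i j x (z : bstate N) : R[i] :=
  (z q == c)%:R * (a i x z * conjc (a j x z)).
pose v i j y z : R[i] := b i y z * conjc (b j y z).
pose J := (I * I * bool)%type.
pose f c (p : J) x := (if p.2 then Re (\sum_z u c p.1.1 p.1.2 x z)
                       else - Im (\sum_z u c p.1.1 p.1.2 x z)) / s x.
pose g (c : bool) (p : J) y := (if p.2 then Re (\sum_z v p.1.1 p.1.2 y z)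
                       else Im (\sum_z v p.1.1 p.1.2 y z)) / t y.
exists J, f, g; split; first by rewrite !card_prod cI card_bool.
move=> c.
have half (A B C : R) : A <= C -> B <= C -> 2^-1 * (A + B) <= C by lra.
have absdiv (r d : R) : 0 < d -> `|r| <= d -> `|r / d| <= 1.
  by move=> d0 rd; rewrite normrM normfV (gtr0_norm d0) ler_pdivrMr // mul1r.
have ReU i j x : `|Re (\sum_z u c i j x z)| <= s x.
  rewrite Re_sum; apply: le_trans (ler_norm_sum _ _ _) _.
  apply: le_trans (half _ _ _ (proj2 (Pa i x)) (proj2 (Pa j x))).
  rewrite -big_split mulr_sumr; apply: ler_sum => z _ /=; rewrite /u.
  case: (z q == c); rewrite ?mul1r ?Re_mul_conj_le // mul0r normr0.
  by rewrite mulr_ge0 ?invr_ge0 ?addr_ge0 ?normsq_ge0.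
have ImU i j x : `|Im (\sum_z u c i j x z)| <= s x.
  rewrite Im_sum; apply: le_trans (ler_norm_sum _ _ _) _.
  apply: le_trans (half _ _ _ (proj2 (Pa i x)) (proj2 (Pa j x))).
  rewrite -big_split mulr_sumr; apply: ler_sum => z _ /=; rewrite /u.
  case: (z q == c); rewrite ?mul1r ?Im_mul_conj_le // mul0r normr0.
  by rewrite mulr_ge0 ?invr_ge0 ?addr_ge0 ?normsq_ge0.
have ReV i j y : `|Re (\sum_z v i j y z)| <= t y.
  rewrite Re_sum; apply: le_trans (ler_norm_sum _ _ _) _.
  apply: le_trans (half _ _ _ (proj2 (Pb i y)) (proj2 (Pb j y))).
  by rewrite -big_split mulr_sumr; apply: ler_sum => z _; exact: Re_mul_conj_le.
have ImV i j y : `|Im (\sum_z v i j y z)| <= t y.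
  rewrite Im_sum; apply: le_trans (ler_norm_sum _ _ _) _.
  apply: le_trans (half _ _ _ (proj2 (Pb i y)) (proj2 (Pb j y))).
  by rewrite -big_split mulr_sumr; apply: ler_sum => z _; exact: Im_mul_conj_le.
split=> [[[i j] e] x|[[i j] e] y|x y].
- by apply: absdiv => //=; case: e; rewrite ?normrN ?ReU ?ImU.
- by apply: absdiv => //=; case: e; rewrite ?ReV ?ImV.
  transitivity (\sum_i \sum_j Re (\sum_z u c i j x z * v i j y z)).
    under [RHS]eq_bigr do under eq_bigr do rewrite Re_sum.
    under [RHS]eq_bigr do rewrite exchange_big.
    rewrite [RHS]exchange_big [LHS]big_mkcond; apply: eq_bigr => z _ /=.
    under eq_bigr do rewrite -Re_sum.
    rewrite -Re_sum.
    have -> : \sum_i \sum_j u c i j x z * v i j y z =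
        (z q == c)%:R * (psi x y z * conjc (psi x y z)).
      rewrite E rmorph_sum big_distrl mulr_sumr; apply: eq_bigr => i _ /=.
      rewrite big_distrr mulr_sumr; apply: eq_bigr => j _ /=.
      by rewrite /u /v rmorphM /=; ring.
    by case: ifP => _; rewrite ?mul1r ?normsqE ?mul0r.
  rewrite -(pair_big xpredT xpredT (fun ij e => f c (ij, e) x * g c (ij, e) y)) /=.
  rewrite -(pair_big xpredT xpredT (fun i j => \sum_e f c (i, j, e) x * g c (i, j, e) y)).
  apply: eq_bigr => i _; apply: eq_bigr => j _; rewrite big_bool /f /g /=.
  have uS : depends_on S (u c i j x).
    move=> z w zw; rewrite /u (agree_onP _ _ _ zw q qS).
    by rewrite (proj1 (Pa i x) _ _ zw) (proj1 (Pa j x) _ _ zw).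
  have vS : depends_on (~: S) (v i j y).
    move=> z w zw; rewrite /v.
    by rewrite (proj1 (Pb i y) _ _ zw) (proj1 (Pb j y) _ _ zw).
  have := congr1 (@complex.Re R) (sumM_depends uS vS).
  rewrite ReM -[2](rmorph_nat (real_complex R) 2) -rmorphXn /= -(st x y).
  have ReZ (r : R) (w : R[i]) : Re (r%:C%C * w) = r * Re w.
    by case: w => w1 w2 /=; rewrite mul0r subr0.
  rewrite ReZ => H; apply: (mulfI (lt0r_neq0 (mulr_gt0 (s0 x) (t0 y)))).
  by rewrite -H; field; rewrite !lt0r_neq0.
Qed.
End Split.

(** * Acceptance probabilities of a protocol *)

Section Protocols.
Variables (R : realType) (n m : nat).
Implicit Type P : protocol R n m.
Local Notation N := (n + n + m)%N.

Lemma split_init (A : {set 'I_N}) :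
  (forall i : 'I_N, (i < n)%N -> i \in A) ->
  (forall i : 'I_N, (n <= i < n + n)%N -> i \notin A) ->
  split_state A 1 (fun x y => @init_state R n m x y).
Proof.
(* Alice owns no qubit of [y] and Bob none of [x], so each part can be defined with the other input
   replaced by zeros. *)
move=> Ax Ay; pose zero := nseq_tuple n false.
pose ix x := @init_bits n m x zero; pose iy y := @init_bits n m zero y.
pose f x z : R := (agree_on A z (ix x))%:R.
pose g y z : R := (agree_on (~: A) z (iy y))%:R.
have fg x y z : agree_on A z (ix x) && agree_on (~: A) z (iy y) =
    (z == @init_bits n m x y).
  have eA i : i \in A -> ix x i = @init_bits n m x y i.
    move=> iA; rewrite !ffunE; case: ifP => // /negbT; rewrite -leqNgt => ni.
    by case: ifP => // ni2; move: (Ay i); rewrite ni ni2 iA => /(_ isT).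
  have eC i : i \in ~: A -> iy y i = @init_bits n m x y i.
    by rewrite inE !ffunE => iA; case: ifP => // /Ax; rewrite (negbTE iA).
  apply/andP/eqP => [[/agree_onP zA /agree_onP zC] | ->].
    apply/ffunP => i; have [iA|iA] := boolP (i \in A); first by rewrite zA ?eA.
    by rewrite zC ?eC ?inE.
  by split; apply/agree_onP => i iA; rewrite ?eA ?eC.
have agreeD (S : {set 'I_N}) z w v : agree_on S z w -> agree_on S z v = agree_on S w v.
  move=> /agree_onP zw; apply: eq_forallb => i.
  by case: (boolP (i \in S)) => //= iS; rewrite zw.
have nb (c : bool) : normsq (c%:R : R[i]) = c%:R.
  by case: c => /=; rewrite ?expr1n ?expr0n addr0.
have pos S (w : bstate N) : 0 < \sum_z ((agree_on S z w)%:R : R).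
  rewrite (bigD1 w) //= ltr_pwDl ?sumr_ge0 //.
  by rewrite (_ : agree_on S w w) //; apply/agree_onP.
exists unit, (fun _ x z => (agree_on A z (ix x))%:R : R[i]),
  (fun _ y z => (agree_on (~: A) z (iy y))%:R : R[i]),
  (fun x => \sum_z f x z), (fun y => \sum_z g y z); split.
- by rewrite card_unit.
- move=> _ x; split; first by move=> z w zw; rewrite (agreeD _ _ _ _ zw).
  by under eq_bigr do rewrite nb.
- move=> _ y; split; first by move=> z w zw; rewrite (agreeD _ _ _ _ zw).
  by under eq_bigr do rewrite nb.
- split=> [x|y|x y]; try exact: pos.
  (* Exactly one basis state agrees with both parts, so the product of the two counts is 2^N. *)
  rewrite (@sumM_depends _ _ A); last 2 first.
  + by move=> z w zw; rewrite /f (agreeD _ _ _ _ zw).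
  + by move=> z w zw; rewrite /g (agreeD _ _ _ _ zw).
  rewrite (bigD1 (@init_bits n m x y)) //= /f /g -natrM mulnb fg eqxx big1 ?addr0 ?mulr1 //.
  by move=> z neq; rewrite -natrM mulnb fg (negbTE neq).
by move=> x y z; rewrite big_const card_unit /= addr0 -natrM mulnb fg.
Qed.

Lemma protocol_terms P : protocol_legal P ->
  exists (J : finType) (f g : bool -> J -> n.-tuple bool -> R),
    #|J| = (2 * 4 ^ cost P)%N /\
    forall c, bounded_terms (f c) (g c) (fun x y => prob_out P x y c).
Proof.
case=> Ax Ay legal [uU lU] qS.
have := split_run (split_init Ax Ay) legal.
rewrite mul1n -/(cost P).
have -> : (2 * 4 ^ cost P = 2 ^ cost P * 2 ^ cost P * 2)%N by rewrite -expnMn mulnC.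
case: (p_final_alice P) uU lU qS => uU lU qS.
  by move=> /(split_unitary uU lU) /(split_measure qS).
move=> /split_swap /(split_unitary uU lU) /(split_measure qS) [J [f [g [cJ H]]]].
exists J, g, f; split=> // c; have [f1 g1 E] := H c; split=> // x y.
by rewrite /prob_out E; apply: eq_bigr => j _; rewrite mulrC.
Qed.

Lemma run_normsq (A : {set 'I_N}) (psi : qstate R N) rs : legal_rounds A rs ->
  \sum_z normsq (run_rounds psi rs z) = \sum_z normsq (psi z).
Proof.
elim: rs A psi => [|r rs IH] A psi //= [uU _ _ legal].
by rewrite (IH _ _ legal) unitary_normsq.
Qed.

Lemma prob_out_sum P x y : protocol_legal P ->
  prob_out P x y true + prob_out P x y false = 1.
Proof.
case=> _ _ legal [uU _] _.
have <- : \sum_z normsq (final_state P x y z) = 1.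
  rewrite unitary_normsq // (run_normsq _ legal).
  rewrite (bigD1 (@init_bits n m x y)) //= /init_state eqxx big1 => [|z /negbTE ->].
    by rewrite /= expr1n expr0n !addr0.
  by rewrite /= expr0n addr0.
rewrite (bigID (fun z : bstate N => z (p_out P) == true)) /=; congr (_ + _).
by apply: eq_bigl => z; case: (z _).
Qed.

Lemma prob_out_ge0 P x y c : 0 <= prob_out P x y c.
Proof. by apply: sumr_ge0 => z _; exact: normsq_ge0. Qed.

End Protocols.

(** * Majority vote on sums of rank-one terms *)

Section Amplification.
Variable R : realType.

(** Since q <= p, replacing l - a factors q by p can only increase the product; this leaves (pq)^l,
    and pq <= 2/9 once p >= 2/3. *)
Lemma minority_le (p q : R) (a b l : nat) :
  0 <= q -> 2 / 3 <= p -> p + q = 1 -> (a <= l)%N -> (a + b = l.*2)%N ->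
  p ^+ a * q ^+ b <= (2 / 9) ^+ l.
Proof.
move=> q0 p23 pq al abl.
have -> : b = (l - a + l)%N by lia.
apply: (@le_trans _ _ ((p * q) ^+ l)); last first.
  by rewrite lerXn2r ?nnegrE //; [nra | lra | nra].
rewrite exprMn exprD mulrA ler_wpM2r ?exprn_ge0 //.
rewrite -[X in _ <= p ^+ X](subnKC al) exprD ler_wpM2l ?exprn_ge0 //; first lra.
by rewrite lerXn2r ?nnegrE //; lra.
Qed.

Lemma prod_outcomes l (p : bool -> R) (s : bstate l) :
  \prod_i p (s i) = p true ^+ weight s * p false ^+ (l - weight s).
Proof.
rewrite subn_weight !expr_sum -big_split; apply: eq_bigr => i _ /=.
by case: (s i); rewrite /= expr0 expr1 ?mulr1 ?mul1r.
Qed.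

(** The event [weight s <= l] is a vote for false, ties included. Each of the at most 4^l wrong
    outcome sequences has probability at most (2/9)^l. *)
Lemma majority_error l (p : bool -> R) (h : bool) :
  (forall c, 0 <= p c) -> p true + p false = 1 -> 2 / 3 <= p h ->
  `|\sum_(s : bstate l.*2 | (weight s <= l)%N) \prod_i p (s i) - (~~ h)%:R|
    <= (8 / 9) ^+ l.
Proof.
move=> p0 p1 ph.
pose T (s : bstate l.*2) := \prod_i p (s i).
have T0 s : 0 <= T s by apply: prodr_ge0.
have sumT : \sum_s T s = 1.
  rewrite /T -(bigA_distr_bigA (fun _ c => p c)) big1 // => i _.
  by rewrite big_bool.
have bound (Q : pred (bstate l.*2)) : (forall s, Q s -> T s <= (2 / 9) ^+ l) ->
    `|\sum_(s | Q s) T s| <= (8 / 9) ^+ l.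
  move=> HQ; rewrite ger0_norm ?sumr_ge0 //.
  apply: (@le_trans _ _ (\sum_(s : bstate l.*2) (2 / 9) ^+ l)).
    rewrite big_mkcond; apply: ler_sum => s _; case: ifP => [/HQ //|_].
    by rewrite exprn_ge0 // divr_ge0.
  rewrite sumr_const card_bstate -[X in X <= _]mulr_natl natrX -muln2 mulnC exprM -exprMn.
  by rewrite le_eqVlt; apply/orP; left; apply/eqP; congr (_ ^+ _); field.
case: h ph => /= ph.
  rewrite subr0; apply: bound => s sl; rewrite /T prod_outcomes.
  by apply: minority_le => //; rewrite subnKC ?weight_le.
move: sumT; rewrite (bigID (fun s => weight s <= l)%N) /= => E.
rewrite distrC -[1%:R]E [X in X - _]addrC addrK.
apply: bound => s; rewrite -ltnNge => sl; rewrite /T prod_outcomes mulrC.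
apply: minority_le => //; rewrite 1?addrC //; last by rewrite subnK ?weight_le.
by lia.
Qed.

(** The vote is a polynomial in the probabilities. Distributing the product over the 2l runs gives
    one term for each outcome sequence and each choice of an index in [J] per run; the vote's
    indicator is absorbed into [f']. *)
Lemma amplify (X Y : Type) (J : finType) (f : bool -> J -> X -> R)
    (g : bool -> J -> Y -> R) (p : bool -> X -> Y -> R) (h : X -> Y -> bool) l :
  (forall c, bounded_terms (f c) (g c) (p c)) ->
  (forall c x y, 0 <= p c x y) ->
  (forall x y, p true x y + p false x y = 1) ->
  (forall x y, 2 / 3 <= p (h x y) x y) ->
  exists (J' : finType) (f' : J' -> X -> R) (g' : J' -> Y -> R) M,
    [/\ #|J'| = ((2 * #|J|) ^ l.*2)%N, bounded_terms f' g' M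
      & forall x y, `|M x y - (~~ h x y)%:R| <= (8 / 9) ^+ l].
Proof.
move=> fgp p0 p1 ph.
pose J' := (bstate l.*2 * {ffun 'I_l.*2 -> J})%type.
pose f' (u : J') x := (weight u.1 <= l)%N%:R * \prod_i f (u.1 i) (u.2 i) x.
pose g' (u : J') y := \prod_i g (u.1 i) (u.2 i) y.
exists J', f', g', (fun x y => \sum_(s : bstate l.*2 | (weight s <= l)%N)
  \prod_i p (s i) x y); split; last first.
- by move=> x y; exact: (majority_error _ (p := fun c => p c x y)).
- have prod_le1 (F : 'I_l.*2 -> R) : (forall i, `|F i| <= 1) -> `|\prod_i F i| <= 1.
    move=> F1; apply: (big_ind (fun r : R => `|r| <= 1)) => //; first by rewrite normr1.
    by move=> r t r1 t1; rewrite normrM mulr_ile1.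
  split=> [[s u] x | [s u] y | x y].
  + rewrite /f' normrM; case: (_ <= _)%N; rewrite ?normr0 ?mul0r // normr1 mul1r.
    by apply: prod_le1 => i; have [f1 _ _] := fgp (s i); exact: f1.
  + by apply: prod_le1 => i; have [_ g1 _] := fgp (s i); exact: g1.
  rewrite -(pair_big xpredT xpredT (fun s u => f' (s, u) x * g' (s, u) y)) /=.
  rewrite big_mkcond; apply: eq_bigr => s _.
  rewrite /f' /g' /=; case: leqP => _; last first.
    by rewrite big1 // => u _; rewrite !mul0r.
  under [RHS]eq_bigr do rewrite mul1r -big_split /=.
  rewrite -(bigA_distr_bigA (fun i j => f (s i) j x * g (s i) j y)).
  by apply: eq_bigr => i _; have [_ _ ->] := fgp (s i).
by rewrite card_prod card_bstate card_ffun card_ord expnMn.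
Qed.

End Amplification.

(** * Binomial estimates and the final bound *)

Lemma central_binomial q : (4 ^ q <= q.*2.+1 * 'C(q.*2, q))%N.
Proof.
elim: q => // q IH.
have e1 := mul_bin_diag q.*2.+2 q; have e2 := mul_bin_down q.*2.+1 q.
rewrite /= in e1 e2; rewrite expnS doubleS.
have e4 : (q.*2.+1 - q = q.+1)%N by lia.
rewrite e4 in e2.
have e5 : ('C(q.*2.+2, q.+1) = 2 * 'C(q.*2.+1, q))%N by nia.
rewrite e5; nia.
Qed.

(** For [r] true the level is one below the centre, where the binomial is smaller by the ratio
    (2q+2)/(2q+1) <= 2. *)
Lemma level_binomial q (r : bool) n : n = (q.*2 + r).*2 ->
  (2 ^ n <= 2 * n.+1 * 'C(n, q.*2))%N.
Proof.
move=> nE; have := central_binomial (q.*2 + r); rewrite -nE.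
have -> : (4 ^ (q.*2 + r) = 2 ^ n)%N by rewrite nE -[RHS](congr1 (expn 2) (mul2n _)) expnM.
case: r nE => /=; rewrite ?addn0 ?addn1 => nE; last by nia.
have := mul_bin_left n q.*2; have -> : (n - q.*2 = q.*2.+2)%N by lia.
nia.
Qed.

Lemma half_le_cost (R : realType) n m (P : protocol R n m) t :
  ~~ odd n -> (n < 2 ^ t)%N -> computes P (@HAM n n./2) ->
  (n./2 <= t.*2.+3 * (24 * cost P + 25))%N.
Proof.
move=> n_even nt [legal correct].
set h := n./2; pose q := h./2; pose r := odd h.
have hE : h = (q.*2 + r)%N by rewrite addnC odd_double_half.
have nE : n = h.*2 by rewrite -[LHS]odd_double_half (negbTE n_even).
have [J [f [g [cJ fg]]]] := protocol_terms legal.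
(* As (8/9)^6 <= 1/2, this [l] makes the error at most 2^-e. The binomial estimates lose 2^(2t+2);
   one more halving lets the error be absorbed. *)
pose e := t.*2.+3; pose l := (6 * e)%N.
have [J' [f' [g' [M [cJ' [f1 g1 ME] Mh]]]]] := amplify l fg
  (fun c x y => prob_out_ge0 P x y c) (fun x y => prob_out_sum x y legal) correct.
pose tup (x : bstate n) := [tuple x i | i < n].
have distE x y : ham_dist (tup x) (tup y) = dist x y.
  by apply: eq_bigr => i _; rewrite !tnth_mktuple.
have := @binom_le_terms R q r h n J' (fun j x => f' j (tup x)) (fun j y => g' j (tup y))
  (fun x y => M (tup x) (tup y)) ((8 / 9) ^+ l) hE nE
  (fun j x => f1 j _) (fun j y => g1 j _) (fun x y => ME _ _).
have close x y : `|M (tup x) (tup y) - (dist x y == h)%:R| <= (8 / 9) ^+ l.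
  by have := Mh (tup x) (tup y); rewrite /HAM negbK distE.
move=> /(_ close); rewrite {}cJ' {}cJ => main.
have eps : (8 / 9) ^+ l <= 2 ^- e :> R.
  by rewrite /l exprM -exprVn lerXn2r ?nnegrE ?exprn_ge0 ?divr_ge0 ?invr_ge0 //; lra.
set K := ((2 * (2 * 4 ^ cost P)) ^ l.*2)%N in main.
have binom : (2 ^ n * 2 ^ h <= 2 ^ t.*2.+2 * ('C(n, q.*2) * 'C(q.*2, q)))%N.
  have b1 : (2 ^ n <= 2 * 2 ^ t * 'C(n, q.*2))%N.
    have nq : n = (q.*2 + r).*2 by rewrite -hE.
    apply: leq_trans (level_binomial nq) _.
    by rewrite leq_mul2r leq_mul2l nt !orbT.
  have b2 : (2 ^ h <= 2 * 2 ^ t * 'C(q.*2, q))%N.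
    apply: (@leq_trans (2 * 4 ^ q)).
      by rewrite (_ : 4 = 2 ^ 2)%N // -expnM -expnS leq_pexp2l // hE; lia.
    have := central_binomial q; have : (q.*2.+1 <= 2 ^ t)%N by lia.
    by nia.
  apply: leq_trans (leq_mul b1 b2) _.
  have -> : (2 ^ t.*2.+2 = 4 * (2 ^ t * 2 ^ t))%N.
    by rewrite !expnS -addnn expnD mulnA.
  by rewrite leq_eqVlt; apply/orP; left; apply/eqP; ring.
have K_ge : (2 ^ h <= 2 ^ e * K)%N.
  rewrite -(ler_nat R) natrM (natrX R 2 h) (natrX R 2 e).
  have N0 : 0 < 2 ^+ n :> R by rewrite exprn_gt0.
  have e0 : 0 < 2 ^+ t.*2.+2 :> R by rewrite exprn_gt0.
  have h0 : 0 < 2 ^+ h :> R by rewrite exprn_gt0.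
  have : 2 ^+ n * 2 ^+ h <=
      2 ^+ t.*2.+2 * (2 ^+ n * (K%:R + (8 / 9) ^+ l * 2 ^+ h)) :> R.
    apply: (le_trans _ (ler_wpM2l (ltW e0) main)).
    by rewrite -!natrX -!natrM ler_nat.
  rewrite mulrCA ler_pM2l // => le1.
  (* The error accounts for at most half of 2^h, so the terms account for the other half. *)
  have le2 : 2 ^+ t.*2.+2 * ((8 / 9) ^+ l * 2 ^+ h) <= 2^-1 * 2 ^+ h :> R.
    rewrite mulrA ler_pM2r //.
    apply: le_trans (ler_wpM2l (ltW e0) eps) _.
    by rewrite /e [X in _ / X]exprS invfM mulrCA mulfV ?mulr1 // lt0r_neq0.
  rewrite /e exprS -mulrA; move: le1 le2; rewrite mulrDr.
  move: (2 ^+ h) (_ * K%:R) (_ * (_ * _)) => u v w. lra.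
have KE : K = (2 ^ ((cost P).*2.+2 * l.*2))%N.
  by rewrite /K expnM !expnS -[in RHS]mul2n expnM.
move: K_ge; rewrite KE -expnD leq_exp2l // => le_h; apply: leq_trans le_h _.
rewrite -/e /l; nia.
Qed.

Lemma linear_lt_pow2 t : (20 <= t)%N -> (150 * t < 2 ^ t.-1)%N.
Proof.
move=> /subnKC <-; move: (t - 20)%N => {t}.
elim=> [|t IH]; first by rewrite addn0; vm_compute.
by rewrite addnS /= -[(20 + t)%N]prednK // expnS; move: IH; lia.
Qed.

(* BQC(HAM_n^{n/2}) = Omega(n / log n): there are c > 0 and n0 such that for
   every even n >= n0, every quantum protocol computing HAM_n^{n/2} with error
   at most 1/3 exchanges at least c * n / ln n qubits. *)
Theorem theorem5p2 (R : realType) :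
  exists2 c : R, 0 < c & exists n0 : nat,
    forall n : nat, ~~ odd n -> (n0 <= n)%N ->
    forall (m : nat) (P : protocol R n m),
      computes P (@HAM n n./2) ->
      c * n%:R / ln (n%:R : R) <= (cost P)%:R.
Proof.
have ln2 : 0 < ln (2 : R) by rewrite ln_gt0 // ltr1n.
(* The constant combines n <= 600 (t-1) C with (t-1) ln 2 <= ln n, where C is the cost. *)
exists (ln 2 / 600); first by rewrite divr_gt0.
exists (2 ^ 20)%N => n n_even n_large m P compP.
pose t := (trunc_log 2 n).+1.
have n_gt0 : (0 < n)%N by apply: leq_trans n_large; rewrite expn_gt0.
have t20 : (20 <= t)%N by rewrite leqW // trunc_log_max.
have {n_large} tlow : (2 ^ t.-1 <= n)%N by apply: trunc_logP.
have nC := half_le_cost n_even (trunc_log_ltn n (ltnSn 1) : (n < 2 ^ t)%N) compP.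
have lin := linear_lt_pow2 t20.
have nE : (n = n./2.*2)%N by rewrite -[LHS]odd_double_half (negbTE n_even).
(* Cost 0 would force n <= 100t + 150, contradicting 150t < 2^(t-1) <= n. For positive cost C, 24C +
   25 <= 49C and the additive constants are absorbed since t >= 20. *)
have le_nC : (n <= 600 * (t.-1 * cost P))%N.
  by case: (cost P) nC => [|C] nC; nia.
have le_ln : ln 2 * t.-1%:R <= ln (n%:R : R).
  rewrite mulr_natr -lnXn // ler_ln ?posrE ?exprn_gt0 ?ltr0n //.
  by rewrite -natrX ler_nat.
have ln_n : 0 < ln (n%:R : R).
  by apply: lt_le_trans le_ln; rewrite mulr_gt0 // ltr0n; lia.
rewrite ler_pdivrMr //.
have := le_nC; rewrite -(ler_nat R) !natrM => le_nCR.
have C0 : 0 <= (cost P)%:R :> R by [].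
have := ler_wpM2l C0 le_ln; have := ler_wpM2l (ltW ln2) le_nCR.
rewrite mulrAC ler_pdivrMr //.
lra.
Qed.
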